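(* Let $N\ge1$, $\omega_1,\dots,\omega_N\in\mathbb{R}$, $\kappa>0$ and $\varepsilon\in(0,1]$ with $\kappa>(2+\varepsilon)\|\Omega\|_\infty$, where $\|\Omega\|_\infty=\max_i|\omega_i|$. For initial data $(\theta_i^0)_{i=1}^N$ let $(\theta_i(t))_{i=1}^N$ solve \[ \dot\theta_i=\omega_i-\frac{\kappa}{N}\sum_{j=1}^N(1+\cos\theta_j)\sin\theta_i,\qquad\theta_i(0)=\theta_i^0, \] and let $R(t)=\frac1N\sum_j(1+\cos\theta_j(t))$. Let $m$ be the normalized Lebesgue measure on $[-\pi,\pi]^N$ ($m([-\pi,\pi]^N)=1$). Then the $m$-measure of the set of initial data $(\theta_i^0)\in[-\pi,\pi]^N$ such that (i) $R(t)\ge\frac1{\sqrt2}-\frac{3\varepsilon}{20}$ for all $t\ge0$; (ii) $\sup_{t\ge0}\theta_i(t)-\inf_{t\ge0}\theta_i(t)<2\pi$ for all $i$; and (iii) for every $i$ and every $t_0\ge0$ with $\cos\theta_i(t_0)\ge-\frac1{\sqrt2}$, one has $\cos\theta_i(t)\ge-\frac1{\sqrt2}$ for all $t\ge t_0$ and $\cos\theta_i(t)\ge\frac1{\sqrt2}$ for all $t\ge t_0+\frac{(2+\varepsilon)\pi}{\kappa-(2+\varepsilon)\|\Omega\|_\infty}$, is at least $1-\exp\left(-\frac{\varepsilon^2N}{25}\right)$. If in addition $\kappa>\left(\frac{\pi e}{2}\right)^{3/2}\|\Omega\|_\infty$, then \[ m\Big\{(\theta_i^0)\in[-\pi,\pi]^N:\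 \sup_{t\ge0}\theta_i(t)-\inf_{t\ge0}\theta_i(t)<2\pi\ \text{for all } i\Big\}\ge1-\left(\sqrt{\frac{\pi e}{2}}\,\frac{\|\Omega\|_\infty^{1/3}}{\kappa^{1/3}}\right)^N. \] *)

(* Defs.v *)
From HB Require Import structures.
From mathcomp Require Import all_boot all_order all_algebra.
From mathcomp Require Import all_classical all_reals all_analysis.
Set Implicit Arguments. Unset Strict Implicit. Unset Printing Implicit Defensive.
Import Order.TTheory GRing.Theory Num.Theory.
Import numFieldNormedType.Exports.
Local Open Scope classical_set_scope.
Local Open Scope ring_scope.

Definition supnorm (R : realType) (N : nat) (w : 'I_N -> R) : R :=
  \big[Num.max/0]_(i < N) `|w i|.

Definition is_flow (R : realType) (N : nat) (w : 'I_N -> R) (kappa : R)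
  (sol : ('I_N -> R) -> 'I_N -> R -> R) : Prop :=
  forall x : 'I_N -> R,
    (forall i, sol x i 0 = x i) /\
    (forall i (t : R),
        is_derive t 1 (sol x i)
          (w i - kappa / N%:R * (\sum_(j < N) (1 + cos (sol x j t))) * sin (sol x i t))).

Definition order_param (R : realType) (N : nat) (th : 'I_N -> R -> R) (t : R) : R :=
  N%:R^-1 * \sum_(j < N) (1 + cos (th j t)).

Definition oscillation (R : realType) (f : R -> R) : \bar R :=
  (ereal_sup [set (f t)%:E | t in [set t : R | (0 <= t)%R]] -
   ereal_inf [set (f t)%:E | t in [set t : R | (0 <= t)%R]])%E.

Definition upd (R : realType) (N : nat) (x : 'I_N -> R) (k : nat) (y : R) : 'I_N -> R :=
  fun i => if nat_of_ord i == k then y else x i.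

Fixpoint iter_int (R : realType) (N : nat) (k : nat)
  (f : ('I_N -> R) -> \bar R) (x : 'I_N -> R) : \bar R :=
  match k with
  | 0 => f x
  | k'.+1 => (\int[@lebesgue_measure R]_(y in `[(- pi)%R, pi]%classic)
                 iter_int k' f (upd x k' y))%E
  end.

(* normalized Lebesgue measure on [-pi,pi]^N:
   m(S) = (2 pi)^{-N} * int_{[-pi,pi]^N} 1_S  (Fubini/Tonelli form) *)
Definition m_box (R : realType) (N : nat) (S : set ('I_N -> R)) : \bar R :=
  (((2 * pi) ^- N)%:E * iter_int N (fun x => (\1_S x)%:E) (fun _ => 0%R))%E.

(* Main.v *)
(** Write W = |w|_oo.  As long as R >= rho, every cos(th_i) increases while it lies
    in [-q, q], provided W < kappa rho s with q^2 + s^2 <= 1; hence no cos(th_i) ever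
    loses more than 1 - q, and R(0) > rho + (1 - q) makes R >= rho self-sustaining.
    Once R >= rho with W < kappa rho, th_i cannot climb through a level L with sin L
    close to 1 nor descend through one with sin L close to -1, which bounds its
    oscillation by less than 2 pi; and cos(th_i) crosses [-1/sqrt 2, 1/sqrt 2] at a
    speed bounded below.

    The first part takes rho = 1/sqrt 2 - 3 eps/20 and q = rho + eps/5, so that
    R(0) > 1 - eps/5 suffices; the second takes rho = tau^2, q = 1 - tau^2, s = tau
    for any tau > (W/kappa)^(1/3), so that R(0) > 2 tau^2 suffices.  Both initial
    conditions are handled by the Chernoff bound
    1_{R(0) <= r} <= prod_i e^(s r) e^(-s (1 + cos x_i)); the one-dimensional
    integral is at most 2 pi e^(-s + s^2/4) for small s (Taylor), and a Gaussian
    integral for large s since 1 + cos y >= 2 (1 - |y|/pi)^2. *)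
Require Import Defs.
From HB Require Import structures.
From mathcomp Require Import all_boot all_order all_algebra.
From mathcomp Require Import all_classical all_reals all_analysis.
From mathcomp Require Import measurable_realfun ring lra.
Set Implicit Arguments.
Unset Strict Implicit.
Unset Printing Implicit Defensive.
Import Order.TTheory GRing.Theory Num.Theory.
Import numFieldNormedType.Exports.
Local Open Scope classical_set_scope.
Local Open Scope ring_scope.

(** * Barriers for scalar functions *)

(** The times in [[a, b]] where [l <= f] form a closed nonempty set, so its supremum [c] belongs to
    it. Past [c] the function is below [l], and the intermediate value theorem on [[c, b]] forces
    [f c = l]. *)
Lemma last_crossing (R : realType) (f : R -> R) (a b l : R) :
  continuous f -> a <= b -> l <= f a -> f b < l ->
  exists c, [/\ a <= c, c < b, f c = l & forall t, c <= t <= b -> f t <= l].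
Proof.
move=> cf ab la bl.
pose S := `[a, b] `&` f @^-1` [set y | l <= y].
have S0 : S !=set0 by exists a; split => //=; rewrite in_itv/= lexx.
have Sb : has_ubound S.
  by exists b => t [/=]; rewrite in_itv/= => /andP[].
have Sc : closed S.
  apply: closedI; first exact: interval_closed.
  by apply: closed_comp; [move=> x _; exact: cf|exact: closed_ge].
have [/= cab lc] : S (sup S).
  by rewrite [S in S _]((closure_id S).1 Sc); exact: closure_sup.
move: cab; rewrite in_itv/= => /andP[ac cb].
have cltb : sup S < b.
  rewrite lt_neqAle cb andbT; apply/eqP => cE.
  by move: lc; rewrite cE leNgt bl.
have after t : sup S < t -> t <= b -> f t < l.
  move=> ct tb; rewrite ltNge; apply/negP => lt.
  have : S t by split => //=; rewrite in_itv/= tb andbT (le_trans ac)// ltW.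
  by move=> /(ub_le_sup Sb); rewrite leNgt ct.
have fcl : f (sup S) = l.
  have [d] := @IVT R f (sup S) b l cb (continuous_subspaceT cf)
    (ltac:(by rewrite ge_min (ltW bl) orbT le_max lc)).
  rewrite in_itv/= => /andP[]; rewrite le_eqVlt => /orP[/eqP<-//|cd db fd].
  by have := after _ cd db; rewrite fd ltxx.
exists (sup S); split => // t /andP[]; rewrite le_eqVlt => /orP[/eqP<- _|ct tb].
  by rewrite fcl.
exact/ltW/after.
Qed.

(** Time reversal and a change of sign, [t |-> - f (- t)], turn a first crossing into a last one. *)
Lemma first_crossing (R : realType) (f : R -> R) (a b l : R) :
  continuous f -> a <= b -> l < f a -> f b <= l ->
  exists c, [/\ a < c, c <= b, f c = l & forall t, a <= t <= c -> l <= f t].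
Proof.
move=> cf ab la bl.
have [||||c [c1 c2 c3 c4]] :=
  @last_crossing R (fun t => - f (- t)) (- b) (- a) (- l).
- move=> x; apply: (@continuous_comp _ _ _ -%R (fun y => - f y)).
    exact: opp_continuous.
  by apply: continuousN; exact: cf.
- by rewrite lerN2.
- by rewrite opprK lerN2.
- by rewrite opprK ltrN2.
exists (- c); split; [lra|lra|lra|move=> t /andP[t1 t2]].
by have := c4 (- t) ltac:(lra); rewrite opprK lerN2.
Qed.

Lemma is_derive_gt0_right (R : realType) (f : R -> R) (c b d : R) :
  c < b -> is_derive c 1 f d -> 0 < d -> exists2 t, c < t < b & f c < f t.
Proof.
move=> cb [/= df dE] d0.
have := df; rewrite /derivable => dcv.
have : h^-1 *: ((f \o shift c) (h *: 1) - f c) @[h --> 0^'] --> d.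
  by rewrite -dE; exact: dcv.
move=> /cvgr_gt/(_ _ d0) /= [e /= e0 He].
pose h := Num.min (e / 2) ((b - c) / 2).
have h0 : 0 < h by rewrite lt_min; apply/andP; split; lra.
have he : h <= e / 2 by rewrite ge_min lexx.
have hb : h <= (b - c) / 2 by rewrite ge_min lexx orbT.
exists (h + c); first by lra.
have := He h; rewrite /= sub0r normrN gtr0_norm// gt_eqF//.
move=> /(_ ltac:(lra) isT); rewrite /= [h *: 1]mulr1 pmulr_rgt0 ?invr_gt0//.
by rewrite subr_gt0.
Qed.

(** If [f b < l], then [f] stays at or below [l] after its last crossing, which a positive
    derivative there forbids. Hence the sign of [df] matters only on the level [l] itself. *)
Lemma barrier (R : realType) (f df : R -> R) (a b l : R) :
  (forall t : R, is_derive t 1 f (df t)) -> a <= b -> l <= f a ->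
  (forall t, a <= t <= b -> f t = l -> 0 < df t) -> l <= f b.
Proof.
move=> dfE ab la Hl; rewrite leNgt; apply/negP => bl.
have cf : continuous f.
  by move=> x; apply/differentiable_continuous/derivable1_diffP; case: (dfE x).
have [c [ac cb fc fle]] := last_crossing cf ab la bl.
have dc : 0 < df c by apply: Hl => //; rewrite ac ltW.
have [t /andP[ct tb]] := is_derive_gt0_right cb (dfE c) dc.
by rewrite ltNge fc fle// (ltW ct) ltW.
Qed.

Lemma is_derive_continuous (R : realType) (f df : R -> R) :
  (forall t : R, is_derive t 1 f (df t)) -> continuous f.
Proof.
by move=> fE x; apply/differentiable_continuous/derivable1_diffP; case: (fE x).
Qed.

(** * Winfree oscillators *)

Lemma is_derive_cos_comp (R : realType) (f : R -> R) (t d : R) :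
  is_derive t 1 f d -> is_derive t 1 (cos \o f) (- sin (f t) * d).
Proof.
by move=> fd; apply: is_derive_eq; rewrite mulrC.
Qed.

(** Where [cos f = l] one has [|sin f| >= s], so the derivative of [cos f], namely
    [u sin^2 f - w sin f], is at least [|sin f| (u |sin f| - |w|) > 0]. *)
Lemma cos_barrier (R : realType) (f u : R -> R) (w s l a b : R) :
  (forall t : R, is_derive t 1 f (w - u t * sin (f t))) ->
  0 < s -> l ^+ 2 + s ^+ 2 <= 1 -> a <= b ->
  (forall t, a <= t <= b -> `|w| < u t * s) ->
  l <= cos (f a) -> l <= cos (f b).
Proof.
move=> fE s0 ls ab wu la.
apply: (barrier (fun t => is_derive_cos_comp (fE t)) ab la) => t tab /= ct.
have := wu t tab; have := sin2cos2 (f t); rewrite ct.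
have := ler_norm w; have := ler_norm (- w); rewrite normrN.
move: (sin _) (u t) `|w| => z v W w1 w2 zl Wv.
have zs : s ^+ 2 <= z ^+ 2 by lra.
have v0 : 0 < v by nra.
have [z0|z0] := lerP 0 z.
  have sz : s <= z by rewrite -(ler_pXn2r (n := 2)) ?nnegrE// ltW.
  have : W < v * z by nra.
  nra.
have sz : s <= - z.
  by rewrite -(ler_pXn2r (n := 2)) ?nnegrE ?sqrrN// ?oppr_ge0 ltW.
have : W < v * - z by nra.
nra.
Qed.

(* If cos (f a) < -q there is nothing to lose; otherwise min(cos (f a), q) is a
   barrier. *)
Lemma cos_drop (R : realType) (f u : R -> R) (w s q a b : R) :
  (forall t : R, is_derive t 1 f (w - u t * sin (f t))) ->
  0 < s -> 0 <= q -> q ^+ 2 + s ^+ 2 <= 1 -> a <= b ->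
  (forall t, a <= t <= b -> `|w| < u t * s) ->
  cos (f a) - (1 - q) <= cos (f b).
Proof.
move=> fE s0 q0 qs ab wu.
have cb := cos_geN1 (f b); have ca := cos_le1 (f a).
have [?|?] := lerP (cos (f a)) (- q); first by lra.
have q1 : q <= 1 by nra.
have [cq|cq] := lerP (cos (f a)) q.
  by apply: le_trans (cos_barrier fE s0 _ ab wu (lexx _)); [lra|nra].
by apply: le_trans (cos_barrier fE s0 qs ab wu (ltW cq)); lra.
Qed.

(** While the cosine lies in [[-h, h]], [|sin f| >= h], so it grows at rate at least [h v]; the
    interval has length [2 h], hence the time [2 / v]. *)
Lemma cos_sweep (R : realType) (f u : R -> R) (w h v a b : R) :
  (forall t : R, is_derive t 1 f (w - u t * sin (f t))) ->
  0 < h -> h ^+ 2 + h ^+ 2 <= 1 -> 0 < v ->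
  (forall t, a <= t -> v <= u t * h - `|w|) ->
  - h <= cos (f a) -> a + 2 / v <= b -> h <= cos (f b).
Proof.
move=> fE h0 hh v0 vu ha ab.
have v20 : 0 < 2 / v by rewrite divr_gt0.
have ltab : a < b by lra.
rewrite leNgt; apply/negP => bh.
have wu t : a <= t -> `|w| < u t * h by move=> /vu; lra.
have above t : a <= t -> - h <= cos (f t).
  move=> at_; apply: (cos_barrier fE h0 _ at_) ha; first by rewrite sqrrN.
  by move=> r /andP[/wu].
(* The level [h] is also a barrier: had the cosine reached it before [b], it could not be below [h]
   at [b]. *)
have below t : a <= t <= b -> cos (f t) < h.
  move=> /andP[at_ tb]; rewrite ltNge; apply/negP => ht.
  suff : h <= cos (f b) by rewrite leNgt bh.
  apply: (cos_barrier fE h0 hh tb) ht => r /andP[tr _].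
  exact/wu/(le_trans at_).
have dE t := is_derive_cos_comp (fE t).
have [c] := MVT ltab (fun t _ => dE t)
  (continuous_subspaceT (is_derive_continuous dE)).
rewrite in_itv/= => /andP[ac cb] cE.
have : h * v <= - sin (f c) * (w - u c * sin (f c)).
  have := above c (ltW ac); have := below c; rewrite (ltW ac) (ltW cb).
  move=> /(_ isT) c1 c2; have := vu c (ltW ac); have := sin2cos2 (f c).
  have := ler_norm w; have := ler_norm (- w); rewrite normrN.
  have := normr_ge0 w.
  move: c1 c2; move: (cos (f c)) (sin _) (u c) `|w|.
  move=> y z p W c1 c2 W0 w1 w2 zy vp.
  have zh : h ^+ 2 <= z ^+ 2 by nra.
  have p0 : 0 < p by nra.
  have [z0|z0] := lerP 0 z.
    have hz : h <= z by rewrite -(ler_pXn2r (n := 2)) ?nnegrE// ltW.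
    have : v + w <= p * z by nra.
    nra.
  have hz : h <= - z.
    by rewrite -(ler_pXn2r (n := 2)) ?nnegrE ?sqrrN// ?oppr_ge0 ltW.
  have : v - w <= p * - z by nra.
  nra.
have := below b; rewrite lexx (ltW ltab) => /(_ isT).
move: cE; rewrite /=; move: (- sin _ * _) => D cE bltD hD.
have : h * v * (2 / v) <= D * (b - a) by apply: ler_pM => //; nra.
have -> : h * v * (2 / v) = 2 * h by field; rewrite gt_eqF.
lra.
Qed.

(** * Levels and oscillation of a single phase *)

Lemma cosD2piz (R : realType) (x : R) (k : int) :
  cos (x + (pi *+ 2) *~ k) = cos x.
Proof.
case: k => n; first exact: (periodicn (@cosD2pi R)).
by rewrite -[in RHS](subrK (pi *+ 2 *+ n.+1) x) (periodicn (@cosD2pi R)).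
Qed.

(* Every interval of length 2 pi - 2 d contains a point within d of pi/2 mod 2 pi. *)
Lemma sin_level (R : realType) (d a : R) : 0 <= d <= pi ->
  exists L, a <= L <= a + (2 * pi - 2 * d) /\ cos d <= sin L.
Proof.
move=> /andP[d0 dpi]; have pi0 := pi_gt0 R.
(* [r] in [[0, 2 pi)] is the offset of [a] from the last maximum of the sine at or before [a]. *)
pose k := Num.floor ((a - pi / 2) / (2 * pi)).
pose r := a - pi / 2 - 2 * pi * k%:~R.
have shift (y : R) : cos (y + 2 * pi * k%:~R) = cos y.
  by rewrite mulrzr mulr_natl cosD2piz.
have aE : a - pi / 2 = r + 2 * pi * k%:~R by rewrite /r; lra.
have r0 : 0 <= r.
  have := Num.Theory.floor_le ((a - pi / 2) / (2 * pi)).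
  rewrite ler_pdivlMr; last lra.
  by rewrite /r /k; lra.
have r2 : r < 2 * pi.
  have := Num.Theory.floorD1_gt ((a - pi / 2) / (2 * pi)).
  rewrite ltr_pdivrMr ?intrD; last lra.
  by rewrite /r /k; lra.
have mono (y : R) : 0 <= y <= d -> cos d <= cos y.
  move=> /andP[y0 yd]; rewrite leNgt ltr_cos ?in_itv/= -?leNgt//; lra.
(* If [a] is within [d] of the previous or the next maximum, [L = a] works. Otherwise [L] is taken
   at distance [d] before the next maximum, and [r > d] keeps it in the window. *)
have [rd|dr] := lerP r d.
  exists a; split; first lra.
  by rewrite -cosBpihalf aE shift mono//; lra.
have [rd|rd] := lerP (2 * pi - d) r.
  exists a; split; first lra.
  rewrite -cosBpihalf aE shift -[cos r]cosN -(cosD2pi (- r)) mono// [pi *+ 2]mulr2n; lra.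
exists (a + (2 * pi - d - r)); split; first lra.
rewrite -cosBpihalf (_ : _ - _ = - d + pi *+ 2 + 2 * pi * k%:~R).
  by rewrite shift cosD2pi cosN.
by rewrite [pi *+ 2]mulr2n; lra.
Qed.

(** At a level [L] with [sin L >= cos d] the velocity [w - u sin L] is negative, so [f] cannot climb
    through it; [sin_level] places such a level within [2 pi - 2 d] above [f s]. *)
Lemma oscillator_spread (R : realType) (f u : R -> R) (w d : R) :
  (forall t : R, is_derive t 1 f (w - u t * sin (f t))) -> 0 <= d <= pi ->
  0 <= cos d -> (forall t, 0 <= t -> `|w| < u t * cos d) ->
  forall s t, 0 <= s -> s <= t -> f t - f s <= 2 * pi - 2 * d.
Proof.
move=> fE dpi cd0 wu s t s0 st.
have [L [/andP[sL Ls] dL]] := sin_level (f s) dpi.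
suff : - L <= - f t by lra.
apply: (barrier (f := fun t => - f t) (fun t => is_deriveN (fE t)) st).
  by rewrite lerN2.
move=> r /andP[sr rt] /oppr_inj fr; rewrite fr.
have := wu r (le_trans s0 sr); have := ler_norm w; have := normr_ge0 w.
have := cos_le1 d; have := sin_le1 L.
move: (cos d) (sin L) (u r) `|w| cd0 dL => c z p W c0 cz z1 c1 W0 wW Wp.
have [p0|p0] := lerP 0 p; nra.
Qed.

Lemma oscillation_le (R : realType) (f : R -> R) (K : R) :
  (forall s t, 0 <= s -> 0 <= t -> f t - f s <= K) ->
  (oscillation f <= K%:E)%E.
Proof.
move=> fK; rewrite /oscillation; set S := [set _ | _ in _].
have S0 : S (f 0)%:E by exists 0 => /=.
have ub s : 0 <= s -> (ereal_sup S <= (f s + K)%:E)%E.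
  move=> s0; apply: ge_ereal_sup => _ [t /= t0 <-].
  by rewrite lee_fin -lerBlDl fK.
(* Finiteness of the supremum allows [K] to be written as [r - (r - K)], and [r - K] is a lower
   bound of all values of [f] at nonnegative times. *)
have : (ereal_sup S \is a fin_num).
  rewrite fin_numE -ltNye -ltey (lt_le_trans _ (ereal_sup_ubound S0)) ?ltNyr//=.
  by rewrite (le_lt_trans (ub 0 (lexx _))) ?ltry.
move=> /fineK; set r := fine _ => rE; rewrite -rE.
rewrite (_ : K%:E = r%:E - (r - K)%:E)%E; last by rewrite -EFinB; congr EFin; lra.
apply: leeB => //; apply: le_ereal_inf_tmp => _ [t /= t0 <-].
by rewrite lee_fin lerBlDr -lee_fin rE ub.
Qed.

(** * The coupled system: order parameter and oscillations *)

Lemma supnorm_ge (R : realType) (N : nat) (w : 'I_N -> R) i :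
  `|w i| <= supnorm w.
Proof. exact: le_bigmax_cond. Qed.

Lemma supnorm_ge0 (R : realType) (N : nat) (w : 'I_N -> R) : 0 <= supnorm w.
Proof. exact: bigmax_ge_id. Qed.

(** The coupling enters only through [kappa * order_param th t], so each phase solves the scalar
    equation of the previous lemmas with this common [u]. *)
Definition winfree (R : realType) (N : nat) (w : 'I_N -> R) (kappa : R)
    (th : 'I_N -> R -> R) :=
  forall i (t : R), is_derive t 1 (th i)
    (w i - kappa * order_param th t * sin (th i t)).

Lemma is_flow_winfree (R : realType) (N : nat) (w : 'I_N -> R) (kappa : R)
    (sol : ('I_N -> R) -> 'I_N -> R -> R) (x : 'I_N -> R) :
  is_flow w kappa sol -> winfree w kappa (sol x).
Proof.
move=> /(_ x)[_ fE] i t; apply: is_derive_eq (fE i t) _.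
by rewrite /order_param !mulrA.
Qed.

Section winfree_dynamics.
Variables (R : realType) (N : nat) (w : 'I_N -> R) (kappa : R).
Variable th : 'I_N -> R -> R.
Hypotheses (N0 : (0 < N)%N) (kappa0 : 0 < kappa) (thE : winfree w kappa th).

Lemma continuous_order_param : continuous (order_param th).
Proof.
move=> t; apply: cvgM; first exact: cvg_cst.
apply: cvg_big => [|i _]; first exact: add_continuous.
apply: cvgD; first exact: cvg_cst.
apply: continuous_comp; last exact: continuous_cos.
exact: (is_derive_continuous (thE i)).
Qed.

(** Up to the first time [c] with [R(c) = rho], [cos_drop] applies to every phase. Averaging gives
    [R(c) >= R(0) - (1 - q) > rho], a contradiction. *)
Lemma order_param_ge (rho q s : R) :
  0 < s -> 0 <= q -> q ^+ 2 + s ^+ 2 <= 1 -> supnorm w < kappa * rho * s ->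
  rho + (1 - q) < order_param th 0 ->
  forall t, 0 <= t -> rho <= order_param th t.
Proof.
move=> s0 q0 qs wk R0 t t0; rewrite leNgt; apply/negP => Rt.
have q1 : q <= 1 by nra.
have R0c : rho < order_param th 0 by lra.
have [c [c0 ct Rc Rge]] := first_crossing continuous_order_param t0 R0c (ltW Rt).
suff : order_param th 0 - (1 - q) <= order_param th c by lra.
(* Writing [1 - q] as a mean of [N] equal terms reduces the claim to one inequality per
   oscillator. *)
rewrite lerBlDr -[1 - q](mulKf (_ : N%:R != 0)) ?pnatr_eq0 -?lt0n//.
rewrite -mulrDr ler_pM2l ?invr_gt0 ?ltr0n//.
rewrite mulr_natl -[X in _ *+ X]card_ord -sumr_const -big_split /=.
apply: ler_sum => i _.
have := @cos_drop _ (th i) _ _ s q 0 c (thE i) s0 q0 qs (ltW c0).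
suff wR v : 0 <= v <= c -> `|w i| < kappa * order_param th v * s.
  by move=> /(_ wR); lra.
move=> /Rge Rv; apply: le_lt_trans (supnorm_ge w i) _; apply: lt_le_trans wk _.
by rewrite ler_pM2r// ler_pM2l.
Qed.

Lemma oscillation_lt (rho : R) : 0 < rho -> supnorm w < kappa * rho ->
  (forall t, 0 <= t -> rho <= order_param th t) ->
  forall i, (oscillation (th i) < (2 * pi)%:E)%E.
Proof.
move=> rho0 wk Rge i.
have k0 : 0 < kappa * rho by rewrite mulr_gt0.
have W0 := supnorm_ge0 w.
have q1 : supnorm w / (kappa * rho) < 1 by rewrite ltr_pdivrMr ?mul1r.
have q0 : 0 <= supnorm w / (kappa * rho) by rewrite divr_ge0// ltW.
have wq : supnorm w = supnorm w / (kappa * rho) * (kappa * rho).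
  by rewrite divfK ?gt_eqF.
(* The midpoint between [supnorm w / (kappa * rho)] and 1: large enough to dominate the frequencies,
   yet below 1, so that [d = acos c] is positive and the spread is strictly less than [2 pi]. *)
pose c := (1 + supnorm w / (kappa * rho)) / 2.
have c1 : -1 <= c < 1 by rewrite /c; lra.
have c1' : -1 <= c <= 1 by rewrite /c; lra.
have d0 := acos_gt0 c1.
have dpi : 0 <= acos c <= pi by rewrite (ltW d0) acos_lepi.
have cd0 : 0 <= cos (acos c) by rewrite acosK ?in_itv//= /c; lra.
have wu t : 0 <= t -> `|w i| < kappa * order_param th t * cos (acos c).
  move=> t0; rewrite acosK ?in_itv//=.
  apply: le_lt_trans (supnorm_ge w i) _.
  apply: (@lt_le_trans _ _ (kappa * rho * c)).
    by rewrite [ltLHS]wq mulrC ltr_pM2l// /c; lra.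
  rewrite ler_wpM2r// ?ler_wpM2l ?Rge// ?(ltW kappa0)//.
  by rewrite /c; lra.
apply: (@le_lt_trans _ _ (2 * pi - 2 * acos c)%:E); last first.
  by rewrite lte_fin; lra.
apply: oscillation_le => s t s0 t0.
have [st|ts] := lerP s t; first exact: (oscillator_spread (thE i) dpi cd0 wu).
(* The reflected phase solves the same equation with frequency [- w i], so the bound on climbs also
   bounds descents. *)
pose g r := - th i r.
have gE (r : R) : is_derive r 1 g
    (- w i - kappa * order_param th r * sin (g r)).
  by apply: is_derive_eq (is_deriveN (thE i r)) _; rewrite sinN; lra.
have := oscillator_spread gE dpi cd0 _ t0 (ltW ts).
rewrite normrN => /(_ wu).
by rewrite /g; lra.
Qed.

End winfree_dynamics.

(** * Chernoff bound on the box *)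

(* The integral of a nonnegative function is a supremum over simple functions, so
   monotonicity needs no measurability; this spares us proving that the set of good
   initial data is measurable. *)
Lemma ge0_le_integral_nonmeasurable d (T : measurableType d) (R : realType)
    (mu : {measure set T -> \bar R}) (D : set T) (f g : T -> \bar R) :
  (forall x, D x -> (0 <= f x)%E) -> (forall x, D x -> (f x <= g x)%E) ->
  (\int[mu]_(x in D) f x <= \int[mu]_(x in D) g x)%E.
Proof.
move=> f0 fg; have g0 x : D x -> (0 <= g x)%E.
  by move=> Dx; rewrite (le_trans (f0 x Dx))// fg.
rewrite !ge0_integralE//; apply: le_ereal_sup => _ [h /= hf <-].
by exists h => // x; rewrite (le_trans (hf x))// lee_restrict.
Qed.

Lemma integral_ge_affine (R : realType) (a b A B V : R) (f : R -> \bar R)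
    (g : R -> R) :
  a <= b -> continuous g -> 0 <= B ->
  (\int[@lebesgue_measure R]_(y in `[a, b]) (g y)%:E <= V%:E)%E ->
  (forall y, 0 <= f y)%E -> (forall y, (A - B * g y)%:E <= f y)%E ->
  ((A * (b - a) - B * V)%:E <= \int[@lebesgue_measure R]_(y in `[a, b]) f y)%E.
Proof.
move=> ab cg B0 gV f0 gf; set mu := @lebesgue_measure R.
have ig : mu.-integrable `[a, b] (EFin \o g).
  apply: continuous_compact_integrable; first exact: segment_compact.
  exact: continuous_subspaceT.
have ic : mu.-integrable `[a, b] (EFin \o cst A).
  apply: continuous_compact_integrable; first exact: segment_compact.
  by apply: continuous_subspaceT => x; exact: cvg_cst.
have iBg : mu.-integrable `[a, b] (EFin \o (fun y => B * g y)).
  exact: (integrableZl _ B ig).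
pose h y := A - B * g y.
have hE : (\int[mu]_(y in `[a, b]) (h y)%:E =
           (A * (b - a))%:E - B%:E * \int[mu]_(y in `[a, b]) (g y)%:E)%E.
  under eq_integral do rewrite EFinB.
  rewrite (integralB_EFin _ ic iBg)//; congr (_ - _)%E.
    rewrite (_ : \int[mu]_(y in `[a, b]) _ = \int[mu]_(y in `[a, b]) cst A%:E y)%E//.
    rewrite integral_cst//= /mu lebesgue_measure_itv/= lte_fin EFinM.
    have [//|ba] := ltP a b.
    by rewrite (_ : b - a = 0) ?mule0//; lra.
  exact: (integralZl _ ig).
apply: (@le_trans _ _ (\int[mu]_(y in `[a, b]) (h y)%:E)%E).
  rewrite hE EFinB; apply: leeB => //.
  by rewrite EFinM lee_wpmul2l.
(* Passing to the positive part of [h] gives a nonnegative minorant of [f], as the comparison of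
   integrals requires. *)
rewrite integralE; apply: (@le_trans _ _ (\int[mu]_(y in `[a, b]) ((EFin \o h)^\+ y))%E).
  by rewrite geeDl// leeNl oppe0 integral_ge0.
apply: ge0_le_integral_nonmeasurable => // y _.
by rewrite funeposE ge_max gf f0.
Qed.

Section iterated_integral.
Variables (R : realType) (N : nat) (g : R -> R) (C V : R).
Variable f : ('I_N -> R) -> \bar R.
Hypotheses (cg : continuous g) (g0 : forall y, 0 <= g y) (C0 : 0 <= C).
Hypothesis gV : (\int[@lebesgue_measure R]_(y in `[(- pi)%R, pi]) (g y)%:E <= V%:E)%E.
Hypothesis f0 : forall x, (0 <= f x)%E.
Hypothesis gf : forall x, ((1 - C * \prod_(i < N) g (x i))%:E <= f x)%E.

Lemma iter_int_ge0 k x : (0 <= iter_int k f x)%E.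
Proof. by elim: k x => //= k IH x; apply: integral_ge0. Qed.

(** [iter_int k] integrates the coordinates below [k]: each of their factors has become [V], while
    the factors of index at least [k] still depend on [x]. *)
Lemma iter_int_ge k x : (k <= N)%N ->
  (((2 * pi) ^+ k - C * V ^+ k * \prod_(i < N | (k <= i)%N) g (x i))%:E
     <= iter_int k f x)%E.
Proof.
have V0 : 0 <= V.
  by rewrite -lee_fin (le_trans _ gV)// integral_ge0// => y _; rewrite lee_fin.
elim: k x => [|k IH] x kN /=.
  by rewrite expr0 mulr1; exact: gf.
pose P := \prod_(i < N | (k < i)%N) g (x i).
have P0 : 0 <= P by apply: prodr_ge0.
rewrite (_ : (_ - _) = (2 * pi) ^+ k * (pi - - pi) - C * V ^+ k * P * V); last first.
  by rewrite !exprSr /P opprK; ring.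
apply: (integral_ge_affine _ cg _ gV).
- by have := pi_ge0 R; lra.
- by rewrite mulr_ge0// mulr_ge0// exprn_ge0.
- by move=> y; exact: iter_int_ge0.
move=> y; apply: le_trans (IH (upd x k y) (ltnW kN)).
(* The factor of coordinate [k] is [g y]; the update leaves the later coordinates untouched. *)
rewrite lee_fin lerB// (bigD1 (Ordinal kN))//= /upd/= eqxx [g y * _]mulrC mulrA.
rewrite ler_wpM2r// ler_wpM2l ?mulr_ge0 ?exprn_ge0//.
rewrite /P le_eqVlt; apply/orP; left; apply/eqP; apply: eq_big => [i|i ki].
  by rewrite [LHS]andbC -(inj_eq val_inj) /= ltn_neqAle eq_sym.
by rewrite gtn_eqF//; case/andP: ki => ki; rewrite -(inj_eq val_inj) /= ltn_neqAle eq_sym => ->.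
Qed.

End iterated_integral.

(** Off [S] the sum is at most [r N], so the product of the [e^(s r) e^(-s (1 + cos x_i))] is at
    least 1. Hence 1 minus this product is a minorant of the indicator of [S] everywhere. *)
Lemma m_box_chernoff (R : realType) (N : nat) (S : set ('I_N -> R)) (s r V : R) :
  0 <= s ->
  (\int[@lebesgue_measure R]_(y in `[(- pi)%R, pi]) (expR (- s * (1 + cos y)))%:E
     <= V%:E)%E ->
  (forall x, r * N%:R < \sum_(i < N) (1 + cos (x i)) -> S x) ->
  ((1 - (expR (s * r) * V / (2 * pi)) ^+ N)%:E <= m_box S)%E.
Proof.
move=> s0 gV SP; have pi0 := pi_gt0 R.
have cg : continuous (fun y : R => expR (- s * (1 + cos y))).
  move=> y; apply: (@continuous_comp _ _ _ (fun y => - s * (1 + cos y)) expR).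
    apply: cvgM; first exact: cvg_cst.
    by apply: cvgD; [exact: cvg_cst|exact: continuous_cos].
  exact: continuous_expR.
have := @iter_int_ge R N _ (expR (s * r) ^+ N) V (fun x => (\1_S x)%:E) cg
  (fun _ => expR_ge0 _) (exprn_ge0 _ (expR_ge0 _)) gV _ _ N (fun=> 0) (leqnn N).
rewrite big_pred0; last by move=> i; rewrite leqNgt ltn_ord.
rewrite mulr1 /m_box => H.
have p0 : 0 < (2 * pi) ^- N :> R by rewrite invr_gt0 exprn_gt0//; lra.
rewrite (_ : 1 - _ = (2 * pi) ^- N * ((2 * pi) ^+ N - expR (s * r) ^+ N * V ^+ N)).
  rewrite EFinM lee_pmul2l//; apply: H => x; first by rewrite lee_fin indicE.
  rewrite lee_fin indicE; case: (boolP (x \in S)) => xS.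
    by rewrite lerBlDr lerDl mulr_ge0 ?exprn_ge0 ?expR_ge0// prodr_ge0// => *; exact: expR_ge0.
  have {}xS : ~ S x by move=> /mem_set; exact/negP.
  rewrite subr_le0 -expR_sum -mulr_sumr -expRM_natl -expRD -[X in X <= _]expR0 ler_expR.
  have : \sum_(i < N) (1 + cos (x i)) <= r * N%:R.
    by rewrite leNgt; apply/negP => /SP.
  nra.
have pn : (2 * pi) ^+ N != 0 :> R by rewrite expf_neq0// gt_eqF//; lra.
move: (2 * pi) pn => p pn; rewrite !exprMn exprVn.
by move: (expR _ ^+ N) (V ^+ N) (p ^+ N) pn => E W P P0; field.
Qed.

(** * Exponential inequalities and one-dimensional integrals *)

Lemma le_at0 (R : realType) (f df : R -> R) (x : R) :
  (forall y : R, is_derive y 1 f (df y)) ->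
  (forall y, 0 <= y * x -> `|y| <= `|x| -> 0 <= x * df y) -> f 0 <= f x.
Proof.
move=> fE df0; have cf := is_derive_continuous fE.
have [x0|x0|->//] := ltgtP x 0.
  have [c] := MVT x0 (fun t _ => fE t) (continuous_subspaceT cf).
  rewrite in_itv/= => /andP[xc c0] fc.
  have : 0 <= x * df c.
    by apply: df0; [nra|rewrite !ltr0_norm//; lra].
  by nra.
have [c] := MVT x0 (fun t _ => fE t) (continuous_subspaceT cf).
rewrite in_itv/= => /andP[c0 cx] fc.
have : 0 <= x * df c.
  by apply: df0; [nra|rewrite !gtr0_norm//; lra].
by nra.
Qed.

(** Doubling the Taylor coefficient 1/24 gives a polynomial [P] for which [P e^(-y)] has derivative
    [e^(-y) y^3 (1/6 - y/12)], of the sign of [y] up to [y = 2]. *)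
Lemma expR_le_quartic (R : realType) (x : R) : x <= 2 ->
  expR x <= 1 + x + x ^+ 2 / 2 + x ^+ 3 / 6 + x ^+ 4 / 12.
Proof.
move=> x2.
pose f (y : R) := (1 + y + y ^+ 2 / 2 + y ^+ 3 / 6 + y ^+ 4 / 12) * expR (- y).
have fE (y : R) : is_derive y 1 f (expR (- y) * (y ^+ 3 * (1 / 6 - y / 12))).
  by apply: is_derive_eq; rewrite /GRing.scale/=; set E := expR _; field.
have := le_at0 (x := x) fE.
rewrite /f oppr0 expR0 mulr1 expRN ler_pdivlMr ?expR_gt0// !expr0n /= !mul0r.
rewrite !addr0 !mul1r; apply => y yx yltx.
have y2 : y <= 2.
  have [x0|x0] := lerP 0 x; last by nra.
  by move: yltx; rewrite (ger0_norm x0); have := ler_norm y; lra.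
have -> : x * (expR (- y) * (y ^+ 3 * (6^-1 - y / 12))) =
  expR (- y) * (y * x * (y ^+ 2 * (6^-1 - y / 12))) by ring.
apply: mulr_ge0; [exact: expR_ge0|apply: (mulr_ge0 yx)].
by apply: mulr_ge0; [exact: sqr_ge0|lra].
Qed.

Lemma expR_ge_quadratic (R : realType) (x : R) : 0 <= x ->
  1 + x + x ^+ 2 / 2 <= expR x.
Proof.
move=> x0.
have fE (y : R) : is_derive y 1 (fun z : R => expR z - (1 + z + z ^+ 2 / 2))
    (expR y - (1 + y)).
  by apply: is_derive_eq; rewrite /GRing.scale/=; field.
have := le_at0 (x := x) fE.
rewrite /= expR0 expr0n /= mul0r !addr0 subrr subr_ge0; apply => y _ _.
by rewrite mulr_ge0// subr_ge0 expR_ge1Dx.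
Qed.

Lemma integral_le_FTC (R : realType) (a b : R) (g h H : R -> R) :
  a < b -> continuous g -> continuous h ->
  (forall y : R, is_derive y 1 H (h y)) ->
  (forall y, 0 <= g y) -> (forall y, g y <= h y) ->
  (\int[@lebesgue_measure R]_(y in `[a, b]) (g y)%:E <= (H b - H a)%:E)%E.
Proof.
move=> ab cg ch HE g0 gh; have cH := is_derive_continuous HE.
rewrite EFinB -(continuous_FTC2 ab (continuous_subspaceT ch)); first last.
- by move=> y _; rewrite derive1E; exact: derive_val.
- split; first by move=> y _; case: (HE y).
  + exact/cvg_at_right_filter/cH.
  + exact/cvg_at_left_filter/cH.
by apply: ge0_le_integral_nonmeasurable => y _; rewrite lee_fin.
Qed.

(** Over a period the odd powers of the cosine in the quartic majorant integrate to 0, while [cos^2]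
    and [cos^4] have means 1/2 and 3/8. What remains is [2 pi e^(-s) (1 + x + x^2 / 2)] with
    [x = s^2 / 4], at most [2 pi e^(-s + x)]. *)
Lemma integral_expR_cos_small (R : realType) (s : R) : 0 <= s -> s <= 2 ->
  (\int[@lebesgue_measure R]_(y in `[(- pi)%R, pi])
     (expR (- s * (1 + cos y)))%:E
     <= (2 * pi * expR (- s + s ^+ 2 / 4))%:E)%E.
Proof.
move=> s0 s2; have pi0 := pi_gt0 R.
pose h (y : R) := expR (- s) * (1 - s * cos y + (s * cos y) ^+ 2 / 2
  - (s * cos y) ^+ 3 / 6 + (s * cos y) ^+ 4 / 12).
pose H (y : R) := expR (- s) * (y - s * sin y
  + s ^+ 2 / 4 * (y + sin y * cos y) - s ^+ 3 / 6 * (sin y - sin y ^+ 3 / 3)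
  + s ^+ 4 / 12 * (3 / 8 * (y + sin y * cos y) + sin y * cos y ^+ 3 / 4)).
have HE (y : R) : is_derive y 1 H (h y).
  apply: is_derive_eq; rewrite /GRing.scale/= /h.
  have := sin2cos2 y; move: (cos y) (sin y) (expR (- s)) => c z E zc.
  (* The derivative of [H] as differentiation yields it, before [sin^2 = 1 - cos^2] is
     substituted. *)
  transitivity (E * (1 - s * c + s ^+ 2 / 4 * (1 - z ^+ 2 + c ^+ 2)
    - s ^+ 3 / 6 * (c - z ^+ 2 * c) + s ^+ 4 / 12 * (3 / 8
    * (1 - z ^+ 2 + c ^+ 2) + (c ^+ 4 - 3 * z ^+ 2 * c ^+ 2) / 4))); first by field.
  by rewrite zc; field.
have ch : continuous h.
  apply: (@is_derive_continuous _ _ (fun y => 'D_1 h y)) => y.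
  exact: derivableP.
have npi : - pi < pi :> R by lra.
apply: le_trans (integral_le_FTC npi _ ch HE _ _) _.
- apply: (@is_derive_continuous _ _
    (fun y => 'D_1 (fun z => expR (- s * (1 + cos z))) y)) => y.
  exact: derivableP.
- by move=> y; exact: expR_ge0.
- move=> y; rewrite /h mulrDr mulr1 expRD ler_pM2l ?expR_gt0//.
  have -> : - s * cos y = - (s * cos y) by ring.
  have sc : - (s * cos y) <= 2.
    by have := cos_geN1 y; have := cos_le1 y; nra.
  by have := expR_le_quartic sc; lra.
rewrite lee_fin /H sinN sinpi expRD.
have := @expR_ge_quadratic _ (s ^+ 2 / 4) (ltac:(by rewrite divr_ge0 ?sqr_ge0)).
move: (expR (s ^+ 2 / 4)) (expR_gt0 (- s)); move: (expR (- s)) => E F E0 FE.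
rewrite (_ : _ - _ = 2 * pi * (E * (1 + s ^+ 2 / 4 + (s ^+ 2 / 4) ^+ 2 / 2))).
  by apply: ler_wpM2l; [lra|apply: ler_wpM2l => //; exact: ltW].
by field.
Qed.

(** Concavity by hand: [h] vanishes at 0 and [pi / 2], so a negative value in between gives points
    [c < d] with [sin c > 2 / pi > sin d], although the sine increases there. *)
Lemma cos_ge_chord (R : realType) (x : R) : 0 <= x <= pi / 2 ->
  1 - 2 / pi * x <= cos x.
Proof.
move=> /andP[x0 xpi]; have pi0 := pi_gt0 R.
pose h (y : R) := cos y - (1 - 2 / pi * y).
have hE (y : R) : is_derive y 1 h (2 / pi - sin y).
  by apply: is_derive_eq; rewrite /GRing.scale/=; ring.
have ch := is_derive_continuous hE.
have h0 : h 0 = 0 by rewrite /h cos0; ring.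
have hpi : h (pi / 2) = 0.
  by rewrite /h cos_pihalf; move: (pi : R) pi0 => p p0; field; rewrite gt_eqF.
rewrite -subr_ge0 -/(h x) leNgt; apply/negP => hx.
have x0' : 0 < x.
  by rewrite lt_neqAle x0 andbT; apply/eqP => xE; move: hx; rewrite -xE h0 ltxx.
have xpi' : x < pi / 2.
  rewrite lt_neqAle xpi andbT; apply/eqP => xE.
  by move: hx; rewrite xE hpi ltxx.
have [c] := MVT x0' (fun t _ => hE t) (continuous_subspaceT ch).
rewrite in_itv/= h0 => /andP[c0 cx] cE.
have [d] := MVT xpi' (fun t _ => hE t) (continuous_subspaceT ch).
rewrite in_itv/= hpi => /andP[xd dpi] dE.
have sc : 2 / pi < sin c by nra.
have sd : sin d < 2 / pi by nra.
have : sin c < sin d by rewrite ltr_sin ?in_itv/=; lra.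
lra.
Qed.

(** The substitution [c (y - a)] maps [[a, b]] to an interval starting at 0, contained in the
    half-line whose Gaussian integral is [sqrt pi / 2]. *)
Lemma integral_gauss_half (R : realType) (a b c : R) : a < b -> 0 < c ->
  (\int[@lebesgue_measure R]_(y in `[a, b]) (gauss_fun (c * (y - a)))%:E
    <= (Num.sqrt pi / 2 / c)%:E)%E.
Proof.
move=> ab c0; set mu := @lebesgue_measure R.
pose F (y : R) := c * (y - a).
have FE (y : R) : is_derive y 1 F c.
  by apply: is_derive_eq; rewrite /GRing.scale/=; ring.
have F'E : derive1 F = cst c.
  by apply/funext => y; rewrite derive1E; exact: derive_val.
have cF := is_derive_continuous FE.
have subst : (\int[mu]_(y in `[F a, F b]) (gauss_fun y)%:E =
    \int[mu]_(y in `[a, b]) (((gauss_fun \o F) * derive1 F) y)%:E)%E.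
  apply: integration_by_substitution_increasing; rewrite ?F'E ?(ltW ab)//.
  - by move=> x y _ _ xy; rewrite /F ltr_pM2l//; lra.
  - by move=> y _; exact: cvg_cst.
  - exact: is_cvg_cst.
  - exact: is_cvg_cst.
  - split; first by move=> y _; case: (FE y).
    + exact/cvg_at_right_filter/cF.
    + exact/cvg_at_left_filter/cF.
  - exact/continuous_subspaceT/continuous_gauss_fun.
have mg : measurable_fun `[a, b] (fun y : R => gauss_fun (F y)).
  apply: measurable_funTS; apply: continuous_measurable_fun => y.
  apply: continuous_comp; [exact: cF|exact: continuous_gauss_fun].
have cI : (c%:E * \int[mu]_(y in `[a, b]) (gauss_fun (F y))%:E =
    \int[mu]_(y in `[F a, F b]) (gauss_fun y)%:E)%E.
  rewrite subst F'E -ge0_integralZl//; last 3 first.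
  - exact/measurable_EFinP.
  - by move=> y _; rewrite lee_fin gauss_fun_ge0.
  - by rewrite lee_fin ltW.
  by apply: eq_integral => y _; rewrite -EFinM mulrC.
rewrite -(@lee_pmul2l _ c%:E)// cI.
rewrite -EFinM (_ : c * _ = Num.sqrt pi / 2); last by field; rewrite gt_eqF.
rewrite -integral0y_gauss; apply: ge0_subset_integral => //.
- apply/measurable_EFinP; apply: measurable_funTS.
  exact: measurable_gauss_fun.
- by move=> y _; rewrite lee_fin gauss_fun_ge0.
- by move=> y /=; rewrite !in_itv/= /F subrr mulr0 => /andP[->].
Qed.

(* On [-pi, pi], 1 + cos y >= 2 (1 - |y|/pi)^2, so the integrand is at most
   g y + g (- y) with g the Gaussian centred at -pi; using the sum rather than |y| avoids
   splitting the interval. *)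
Lemma integral_expR_cos_large (R : realType) (s c : R) : 0 < c ->
  2 * s = (c * pi) ^+ 2 ->
  (\int[@lebesgue_measure R]_(y in `[(- pi)%R, pi])
     (expR (- s * (1 + cos y)))%:E <= (Num.sqrt pi / c)%:E)%E.
Proof.
move=> c0 sc; have pi0 := pi_gt0 R; set mu := @lebesgue_measure R.
pose g (y : R) := gauss_fun (c * (y - - pi)).
have npi : - pi < pi :> R by lra.
have s0 : 0 <= s by have := sqr_ge0 (c * pi); lra.
have cg : continuous g.
  move=> y; apply: (continuous_comp (f := fun y => c * (y - - pi))).
    by apply: cvgM; [exact: cvg_cst|apply: cvgB; [exact: cvg_id|exact: cvg_cst]].
  exact: continuous_gauss_fun.
have mg : measurable_fun `[(- pi)%R, pi] g.
  apply: measurable_funTS; exact: continuous_measurable_fun.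
have mgN : measurable_fun `[(- pi)%R, pi] (fun y : R => g (- y)).
  apply: measurable_funTS; apply: continuous_measurable_fun => y.
  by apply: continuous_comp; [exact: opp_continuous|exact: cg].
have gbound y : - pi <= y <= pi ->
    expR (- s * (1 + cos y)) <= g y + g (- y).
  wlog y0 : y / y <= 0.
    move=> H ypi; have [/H->//|/ltW y0] := lerP y 0.
    by rewrite [leRHS]addrC; have := H (- y); rewrite cosN opprK; apply; lra.
  move=> ypi; apply: (@le_trans _ _ (g y)); last by rewrite lerDl gauss_fun_ge0.
  rewrite /g /gauss_fun ler_expR.
  have yE : y = (y / 2) *+ 2 by rewrite mulr2n; lra.
  have y2 : 0 <= - (y / 2) <= pi / 2 by lra.
  have := cos_ge_chord y2; rewrite cosN => cy.
  rewrite [cos y](_ : _ = cos (y / 2) ^+ 2 *+ 2 - 1); last first.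
    by rewrite {1}yE cos_mulr2n.
  rewrite exprMn.
  have -> : y - - pi = pi * (1 - 2 / pi * - (y / 2)).
    by move: (pi : R) pi0 => p p0; field; rewrite gt_eqF.
  rewrite exprMn mulrA -exprMn -sc.
  have z0 : 0 <= 1 - 2 / pi * - (y / 2).
    rewrite subr_ge0 -ler_pdivlMl ?divr_gt0// invf_div; lra.
  move: (cos (y / 2)) (1 - _) z0 cy => C z z0 zC.
  have : z ^+ 2 <= C ^+ 2 by rewrite ler_pXn2r ?nnegrE// (le_trans z0).
  rewrite mulr2n; nra.
apply: (@le_trans _ _ (\int[mu]_(y in `[(- pi)%R, pi]) ((g y)%:E + (g (- y))%:E))%E).
  apply: ge0_le_integral_nonmeasurable => y /=; rewrite lee_fin ?expR_ge0//.
  by rewrite in_itv/=; exact: gbound.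
rewrite ge0_integralD//; try by move=> y _; rewrite lee_fin gauss_fun_ge0.
all: try exact/measurable_EFinP.
have -> : (\int[mu]_(y in `[(- pi)%R, pi]) (g (- y))%:E =
           \int[mu]_(y in `[(- pi)%R, pi]) (g y)%:E)%E.
  have := @integration_by_substitution_oppr _ g (- pi) pi (ltW npi).
  by rewrite opprK => <- //; exact: continuous_subspaceT.
have := integral_gauss_half npi c0 => H.
by apply: le_trans (leeD H H) _; rewrite -EFinD lee_fin; lra.
Qed.

(** * Consequences of a large initial order parameter *)

Lemma invr_sqrt2_bounds (R : realType) :
  [/\ 7 / 10 <= 1 / Num.sqrt 2 :> R, 1 / Num.sqrt 2 <= 71 / 100 :> R
    & (1 / Num.sqrt 2) ^+ 2 = 1 / 2 :> R].
Proof.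
have h2 : (1 / Num.sqrt 2) ^+ 2 = 1 / 2 :> R.
  by rewrite expr_div_n expr1n sqr_sqrtr//; lra.
have h0 : 0 <= 1 / Num.sqrt 2 :> R by rewrite divr_ge0// sqrtr_ge0.
by split => //; rewrite -(ler_pXn2r (n := 2)) ?nnegrE// ?h2; lra.
Qed.

Lemma order_param0 (R : realType) (N : nat) (w : 'I_N -> R) (kappa r : R)
    (sol : ('I_N -> R) -> 'I_N -> R -> R) (x : 'I_N -> R) :
  (0 < N)%N -> is_flow w kappa sol ->
  r * N%:R < \sum_(i < N) (1 + cos (x i)) -> r < order_param (sol x) 0.
Proof.
move=> N0 /(_ x)[sol0 _] rx; rewrite /order_param.
under eq_bigr do rewrite sol0.
by rewrite mulrC ltr_pdivlMr// ltr0n.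
Qed.

Lemma trapping_of_order_param (R : realType) (N : nat) (w : 'I_N -> R) (kappa eps : R)
    (th : 'I_N -> R -> R) :
  (0 < N)%N -> 0 < kappa -> 0 < eps -> eps <= 1 ->
  (2 + eps) * supnorm w < kappa -> winfree w kappa th ->
  1 - eps / 5 < order_param th 0 ->
  [/\ forall t, 0 <= t -> 1 / Num.sqrt 2 - 3 * eps / 20 <= order_param th t,
      forall i, (oscillation (th i) < (2 * pi)%:E)%E
    & forall i (t0 : R), 0 <= t0 -> - (1 / Num.sqrt 2) <= cos (th i t0) ->
        (forall t, t0 <= t -> - (1 / Num.sqrt 2) <= cos (th i t)) /\
        (forall t,
           t0 + (2 + eps) * pi / (kappa - (2 + eps) * supnorm w) <= t ->
           1 / Num.sqrt 2 <= cos (th i t))].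
Proof.
move=> N0 k0 e0 e1 wk thE R0.
have [h1 h2 hh] := invr_sqrt2_bounds R.
move: (1 / Num.sqrt 2) h1 h2 hh => h h1 h2 hh.
have W0 := supnorm_ge0 w.
pose rho := h - 3 * eps / 20.
have rho0 : 0 < rho by rewrite /rho; lra.
have Rge : forall t, 0 <= t -> rho <= order_param th t.
  (* Here [q = rho + eps / 5], and [s] is lowered by slightly more than [q] exceeds [h], so that
     [q^2 + s^2 <= 2 h^2 = 1]. *)
  apply: (order_param_ge N0 k0 thE (q := h + eps / 20) (s := h - 7 * eps / 100)).
  - lra.
  - lra.
  - nra.
  - have : 1 <= (2 + eps) * (rho * (h - 7 * eps / 100)).
      (* The term in [h^2 - 1/2] vanishes; the factor of [eps] left over is nonnegative by the
         numerical bounds on [h]. *)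
      rewrite (_ : _ * _ = 1 + (2 + eps) * (h ^+ 2 - 1 / 2) + eps * (1 / 2
        - 11 / 25 * h + eps * (21 / 1000 + 21 / 2000 * eps - 11 / 50 * h))).
        by rewrite hh subrr mulr0 addr0 lerDl; apply: mulr_ge0; nra.
      by rewrite /rho; field.
    have e2 : 0 < 2 + eps by lra.
    move=> X1; rewrite -(ltr_pM2l e2); apply: lt_le_trans wk _.
    by rewrite -mulrA mulrCA ler_peMr// ltW.
  - by rewrite /rho; lra.
have rh : 1 <= (2 + eps) * (rho * h).
  rewrite (_ : _ * _ = 1 + (2 + eps) * (h ^+ 2 - 1 / 2)
    + eps * (1 / 2 - 3 / 10 * h - 3 / 20 * eps * h)).
    by rewrite hh subrr mulr0 addr0 lerDl; apply: mulr_ge0; nra.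
  by rewrite /rho; field.
pose v := kappa * rho * h - supnorm w.
have vE : kappa - (2 + eps) * supnorm w <= (2 + eps) * v by rewrite /v; nra.
have v0 : 0 < v by nra.
have vu i t : 0 <= t -> v <= kappa * order_param th t * h - `|w i|.
  move=> t0; have := supnorm_ge w i; have := Rge t t0; rewrite /v => Rt wi.
  apply: lerB => //.
  by rewrite ler_wpM2r ?ler_wpM2l ?(ltW k0)//; lra.
split => //.
  apply: (oscillation_lt k0 thE rho0 _ Rge).
  by move: v0; rewrite /v; nra.
move=> i t0 t00 ht0; split=> t tt.
  apply: (cos_barrier (thE i) (s := h) _ _ tt _ ht0); [lra|rewrite sqrrN; lra|].
  by move=> r /andP[tr _]; have := vu i r (le_trans t00 tr); lra.
apply: (cos_sweep (thE i) (v := v) _ _ v0 _ ht0); [lra|lra| |].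
  by move=> r tr; exact/vu/(le_trans t00).
apply: le_trans tt; rewrite lerD2l ler_pdivrMr// mulrAC ler_pdivlMr; last lra.
(* The sweep takes time [2 / v], where [(2 + eps) v >= kappa - (2 + eps) W]; the stated delay
   follows from [2 <= pi]. *)
have := pi_ge2 R; nra.
Qed.

Lemma spread_of_order_param (R : realType) (N : nat) (w : 'I_N -> R)
    (kappa tau : R) (th : 'I_N -> R -> R) :
  (0 < N)%N -> 0 < kappa -> 0 < tau -> tau < 1 ->
  supnorm w < kappa * tau ^+ 3 -> winfree w kappa th ->
  2 * tau ^+ 2 < order_param th 0 ->
  forall i, (oscillation (th i) < (2 * pi)%:E)%E.
Proof.
move=> N0 k0 t0 t1 wk thE R0.
have tt0 : 0 < tau ^+ 2 by rewrite exprn_gt0.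
have tt1 : tau ^+ 2 < 1 by rewrite expr_lt1// ltW.
apply: (oscillation_lt k0 thE tt0).
  apply: lt_le_trans wk _; rewrite ler_pM2l// exprSr.
  by rewrite ler_piMr// ltW.
(* With these values [q^2 + s^2 = 1 - tau^2 + tau^4 <= 1] and [rho + (1 - q) = 2 tau^2]. *)
apply: (order_param_ge N0 k0 thE (q := 1 - tau ^+ 2) (s := tau) t0).
- lra.
- by move: (tau ^+ 2) tt0 tt1 => z; nra.
- by rewrite -mulrA -exprSr.
- lra.
Qed.

(** * Measure bounds and conclusion *)

Lemma m_box_chernoff_small (R : realType) (N : nat) (S : set ('I_N -> R))
    (a : R) : 0 <= a -> a <= 1 ->
  (forall x, (1 - a) * N%:R < \sum_(i < N) (1 + cos (x i)) -> S x) ->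
  ((1 - expR (- (a ^+ 2 * N%:R)))%:E <= m_box S)%E.
Proof.
move=> a0 a1 SP; have pi0 := pi_gt0 R.
(* The exponent per coordinate is [s (1 - a) - s + s^2 / 4], minimal at [s = 2 a] with value
   [- a^2]. *)
have s0 : 0 <= 2 * a by lra.
have s2 : 2 * a <= 2 by lra.
apply: le_trans (m_box_chernoff s0 (integral_expR_cos_small s0 s2) SP).
rewrite lee_fin lerB//.
rewrite -[- (a ^+ 2 * _)]mulNr (expRM_natr N) lerXn2r ?nnegrE ?expR_ge0//.
  by rewrite divr_ge0 ?mulr_ge0 ?expR_ge0//; lra.
have p2 : 2 * pi != 0 :> R by rewrite gt_eqF//; lra.
rewrite mulrCA [2 * pi * _]mulrC mulfK//.
by rewrite -expRD ler_expR; lra.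
Qed.

Lemma m_box_chernoff_large (R : realType) (N : nat) (S : set ('I_N -> R))
    (tau : R) : 0 < tau ->
  (forall x, 2 * tau ^+ 2 * N%:R < \sum_(i < N) (1 + cos (x i)) -> S x) ->
  ((1 - (Num.sqrt (pi * expR 1 / 2) * tau) ^+ N)%:E <= m_box S)%E.
Proof.
move=> tau0 SP; have pi0 := pi_gt0 R.
(* With [r = 2 tau^2], the quantity [e^(s r) / sqrt s] is minimal at [s r = 1/2]; [c] is then fixed
   by [2 s = (c pi)^2]. *)
pose s := (4 * tau ^+ 2)^-1; pose c := (Num.sqrt 2 * tau * pi)^-1.
have q2 : 0 < Num.sqrt 2 :> R by rewrite sqrtr_gt0.
have c0 : 0 < c by rewrite invr_gt0 !mulr_gt0.
have s0 : 0 <= s by rewrite invr_ge0 mulr_ge0// sqr_ge0.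
have sc : 2 * s = (c * pi) ^+ 2.
  rewrite /c invfM mulfVK ?gt_eqF// exprVn exprMn sqr_sqrtr// /s.
  by field; rewrite gt_eqF.
apply: le_trans (m_box_chernoff s0 (integral_expR_cos_large c0 sc) SP).
have l0 : 0 <= expR (s * (2 * tau ^+ 2)) * (Num.sqrt pi / c) / (2 * pi).
  apply: divr_ge0; last lra.
  by rewrite mulr_ge0 ?expR_ge0// divr_ge0 ?sqrtr_ge0// ltW.
have r0 : 0 <= Num.sqrt (pi * expR 1 / 2) * tau.
  by rewrite mulr_ge0 ?sqrtr_ge0// ltW.
rewrite lee_fin lerB// lerXn2r ?nnegrE//.
rewrite -(ler_pXn2r (n := 2)) ?nnegrE//.
have pe0 : 0 <= pi * expR 1 / 2 :> R.
  by rewrite divr_ge0// mulr_ge0 ?expR_ge0// ltW.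
rewrite !exprMn !exprVn /c invrK !exprMn !sqr_sqrtr//; last exact: ltW.
rewrite -[expR (s * _) ^+ 2]expRM_natl.
have -> : 2%:R * (s * (2 * tau ^+ 2)) = 1 by rewrite /s; field; rewrite gt_eqF.
move: (pi : R) pi0 (expR 1) => p p0 e.
by rewrite le_eqVlt; apply/orP; left; apply/eqP; field; rewrite gt_eqF.
Qed.

(** Lets [tau] tend from above to the critical value, where the strict inequality required by
    [spread_of_order_param] becomes an equality. *)
Lemma le_ereal_right_limit (R : realType) (f : R -> R) (X : \bar R) (a b : R) :
  {for a, continuous f} -> a < b ->
  (forall t, a < t -> t < b -> ((f t)%:E <= X)%E) -> ((f a)%:E <= X)%E.
Proof.
move=> cf ab fX.
have fa : (EFin \o f) t @[t --> a^'+] --> (f a)%:E.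
  apply: cvg_EFin; first exact: nearW.
  exact: cvg_at_right_filter.
apply: (cvge_to_le fa); near=> t; apply: fX; near: t.
  exact: nbhs_right_gt.
exact: nbhs_right_lt.
Unshelve. all: by end_near.
Qed.

Unset Implicit Arguments.

Theorem theorem1p6 (R : realType) (N : nat) (w : 'I_N -> R) (kappa eps : R)
  (sol : ('I_N -> R) -> 'I_N -> R -> R) :
  (1 <= N)%N -> 0 < kappa -> 0 < eps -> eps <= 1 ->
  (2 + eps) * supnorm w < kappa ->
  is_flow w kappa sol ->
  ((1 - expR (- (eps ^+ 2 * N%:R / 25)))%:E <=
     m_box [set x |
       ((forall t : R, 0 <= t ->
          1 / Num.sqrt 2 - 3 * eps / 20 <= order_param (sol x) t) /\
       (forall i, (oscillation (sol x i) < (2 * pi)%:E)%E) /\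
       (forall i (t0 : R), 0 <= t0 -> - (1 / Num.sqrt 2) <= cos (sol x i t0) ->
          (forall t, t0 <= t -> - (1 / Num.sqrt 2) <= cos (sol x i t)) /\
          (forall t, t0 + (2 + eps) * pi / (kappa - (2 + eps) * supnorm w) <= t ->
             1 / Num.sqrt 2 <= cos (sol x i t))))%R])%E /\
  (powR (pi * expR 1 / 2) (3 / 2) * supnorm w < kappa ->
   ((1 - (Num.sqrt (pi * expR 1 / 2) * (powR (supnorm w) (1 / 3) / powR kappa (1 / 3))) ^+ N)%:E
      <= m_box [set x | forall i, (oscillation (sol x i) < (2 * pi)%:E)%E])%E).
Proof.
move=> N0 k0 e0 e1 wk flow; have W0 := supnorm_ge0 w; split.
  have a0 : 0 <= eps / 5 by lra.
  have a1 : eps / 5 <= 1 by lra.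
  have -> : eps ^+ 2 * N%:R / 25 = (eps / 5) ^+ 2 * N%:R by field.
  apply: (m_box_chernoff_small a0 a1) => x xs /=.
  have [i1 i2 i3] := trapping_of_order_param N0 k0 e0 e1 wk (is_flow_winfree x flow)
    (order_param0 N0 flow xs).
  by split.
move=> _; set S := [set x | _]; set K := Num.sqrt _.
pose tau0 := powR (supnorm w) (1 / 3) / powR kappa (1 / 3).
have cube (x : R) : 0 <= x -> powR x (1 / 3) ^+ 3 = x.
  by move=> x0; rewrite -powR_mulrn ?powR_ge0// -powRrM divfK// powRr1.
have pk0 : 0 < powR kappa (1 / 3) by rewrite powR_gt0.
have tau0_ge0 : 0 <= tau0 by rewrite divr_ge0 ?powR_ge0.
have tau0K : kappa * tau0 ^+ 3 = supnorm w.
  rewrite /tau0 expr_div_n !cube// ?(ltW k0)// mulrC divfK//.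
  by rewrite gt_eqF.
(* Since [kappa * tau0^3 = supnorm w < kappa]; this leaves room for values of [tau] between [tau0]
   and 1. *)
have tau0_lt1 : tau0 < 1.
  have [//|tau1] := ltP tau0 1.
  have : 1 <= tau0 ^+ 3 by rewrite exprn_ege1.
  by nra.
apply: (@le_ereal_right_limit _ (fun t => 1 - (K * t) ^+ N) _ tau0 1) => //.
  apply: cvgB; first exact: cvg_cst.
  apply: (@continuous_comp _ _ _ (fun t => K * t) (fun t => t ^+ N)).
    by apply: cvgM; [exact: cvg_cst|exact: cvg_id].
  exact: exprn_continuous.
move=> t t0 t1; have tgt0 : 0 < t by apply: le_lt_trans t0.
apply: (m_box_chernoff_large tgt0) => x xs.
apply: (spread_of_order_param N0 k0 tgt0 t1 _ (is_flow_winfree x flow)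
  (order_param0 N0 flow xs)).
by rewrite -tau0K ltr_pM2l// ltrXn2r// nnegrE ltW.
Qed.
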